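(* Let $R=(r_1,\ldots,r_n)$ and $S=(s_1,\ldots,s_n)$ be nonnegative integral vectors. Then the convex hull of $\mathcal{A}^{\pm}(R,S)$ equals the set of $n\times n$ real matrices $A=[a_{ij}]$ satisfying $\sum_{j=1}^n a_{ij}=r_i$ $(1\le i\le n)$, $\sum_{i=1}^n a_{ij}=s_j$ $(1\le j\le n)$, and $-1\le a_{ij}\le 1$ $(1\le i,j\le n)$.
   Context: $\mathcal{A}^{\pm}(R,S)$ denotes the set of all $n\times n$ matrices with entries in $\{0,1,-1\}$ with row sum vector $R$ and column sum vector $S$. *)

(* Defs.v *)
From HB Require Import structures.
From mathcomp Require Import all_boot all_order all_algebra.
From mathcomp Require Import classical_sets reals convex.

Set Implicit Arguments.
Unset Strict Implicit.
Unset Printing Implicit Defensive.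

Import Order.TTheory GRing.Theory Num.Theory.

Local Open Scope classical_set_scope.
Local Open Scope ring_scope.

Definition convex_hull (K : numDomainType) (V : lmodType K) (X : set V) :
    set V :=
  smallest (@convex_set K V) X.

(* The matrices are taken over K, so that the set lives in the real vector
   space in which the convex hull is formed. *)
Definition signed_matrices (K : realType) (n : nat) (r s : 'rV[nat]_n) :
    set 'M[K]_n :=
  [set A | [/\ forall i j, A i j \in [:: 0; 1; -1],
               forall i, \sum_j A i j = (r ord0 i)%:R
             & forall j, \sum_i A i j = (s ord0 j)%:R]].

Arguments signed_matrices K {n} r s.

(* Main.v *)
(* Since line sums are integers, a row or column of a matrix A of the polytope
   containing one non-integral entry contains another.  Comparing the number of
   non-integral entries with the number of lines through them yields a nonzero
   matrix D with zero line sums supported on these entries.  Moving from A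
   along D and along -D until an entry reaches 1 or -1 exhibits A as a convex
   combination of two points of the polytope with fewer non-integral entries;
   a point with none is a (0,1,-1)-matrix. *)
Require Import Defs.
From HB Require Import structures.
From mathcomp Require Import all_boot all_order all_algebra.
From mathcomp Require Import classical_sets reals convex.
From mathcomp Require Import interval_inference ring lra zify.

Set Implicit Arguments.
Unset Strict Implicit.
Unset Printing Implicit Defensive.

Import Order.TTheory GRing.Theory Num.Theory.

Local Open Scope classical_set_scope.
Local Open Scope ring_scope.

(** The fibres of [f] over the image partition [P], and each contains at least two elements. *)
Lemma leq_double_card_imset (T U : finType) (f : T -> U) (P : {set T}) :
  (forall x, x \in P -> exists2 y, y \in P & y != x /\ f y = f x) ->
  (#|(f @: P)%SET| * 2 <= #|P|)%N.
Proof.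
move=> fP; rewrite -[leqRHS]sum1_card (partition_big_imset f) /=.
rewrite -sum_nat_const; apply: leq_sum => _ /imsetP[x xP ->].
rewrite sum1dep_card; apply/card_gt1P.
have [y yP [yx fyx]] := fP _ xP.
by exists y, x; rewrite !inE xP yP fyx eqxx.
Qed.

(** With fewer equations than unknowns, the rank of the coefficient matrix is below its number of
    rows, so its left kernel has a nonzero vector. This vector is extended by zero outside [P]. *)
Lemma homogeneous_system (F : fieldType) (S T : finType) (P : {set S})
    (B : {set T}) (M : S -> T -> F) : (#|B| < #|P|)%N ->
  exists v : S -> F, [/\ exists x, v x != 0, forall x, x \notin P -> v x = 0
    & forall t, t \in B -> \sum_s v s * M s t = 0].
Proof.
move=> BP; pose A : 'M[F]_(#|P|, #|B|) :=
  \matrix_(k, l) M (enum_val k) (enum_val l).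
have : ~~ row_free A.
  by rewrite /row_free neq_ltn (leq_ltn_trans (rank_leq_col A)).
rewrite -kermx_eq0 => /rowV0Pn[w /sub_kermxP wA /rV0Pn[k0 wk0]].
have x0P := enum_valP k0.
pose v s := if s \in P then w 0 (enum_rank_in x0P s) else 0.
have vE k : v (enum_val k) = w 0 k by rewrite /v enum_valP enum_valK_in.
exists v; split=> [||t tB].
- by exists (enum_val k0); rewrite vE.
- by move=> x /negbTE xP; rewrite /v xP.
- rewrite (bigID (mem P)) /= [X in _ + X]big1 ?addr0; last first.
    by move=> s /negbTE sP; rewrite /v sP mul0r.
  rewrite big_enum_val.
  have /matrixP/(_ 0 (enum_rank_in tB t)) := wA; rewrite !mxE => wAt.
  by rewrite -[RHS]wAt; apply: eq_bigr => k _; rewrite vE mxE enum_rankK_in.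
Qed.

(* A line of P carries at least two cells, so P has at least as many cells as
   it has lines; one of the line constraints is implied by the others. *)
Lemma exists_zero_line_sums (F : fieldType) (m n : nat)
    (P : {set 'I_m * 'I_n}) : P != finset.set0 ->
  (forall x, x \in P -> exists2 y, y \in P & y != x /\ y.1 = x.1) ->
  (forall x, x \in P -> exists2 y, y \in P & y != x /\ y.2 = x.2) ->
  exists D : 'M[F]_(m, n), [/\ D != 0,
    forall i j, (i, j) \notin P -> D i j = 0,
    forall i, \sum_j D i j = 0 & forall j, \sum_i D i j = 0].
Proof.
move=> /set0Pn[x0 x0P] P1 P2.
have c1 := leq_double_card_imset P1; have c2 := leq_double_card_imset P2.
set I := (_ @: P)%SET in c1; set J := (_ @: P)%SET in c2.
have x0J : x0.2 \in J by apply: imset_f.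
(* The column of [x0] is left out: [c1] and [c2] only give [#|I| + #|J| <= #|P|], while the system
   needs strictly fewer equations than unknowns. *)
pose B := ((inl @: I) :|: (inr @: (J :\ x0.2)))%SET.
pose M (x : 'I_m * 'I_n) (t : 'I_m + 'I_n) : F :=
  match t with inl i => (x.1 == i)%:R | inr j => (x.2 == j)%:R end.
have BP : (#|B| < #|P|)%N.
  rewrite (cardsD1 x0.2 J) x0J in c2.
  have : (#|B| <= #|I| + #|(J :\ x0.2)%SET|)%N.
    apply: leq_trans (leq_card_setU _ _) _.
    by apply: leq_add; apply: leq_imset_card.
  by move: c1 c2; move: #|P| #|B| #|I| #|(_ :\ _)%SET| => p b k l; lia.
have [v [[x vx] v0 vM]] := homogeneous_system M BP.
pose D : 'M[F]_(m, n) := \matrix_(i, j) v (i, j).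
have rowD i : \sum_j D i j = \sum_x v x * M x (inl i).
  have -> : \sum_x v x * M x (inl i) = \sum_k \sum_j v (k, j) * (k == i)%:R.
    by rewrite pair_bigA; apply: eq_bigr => -[].
  rewrite (bigD1 i) //= [X in _ + X]big1 ?addr0.
    by apply: eq_bigr => j _; rewrite mxE eqxx mulr1.
  by move=> k /negbTE ki; rewrite big1 // => j _; rewrite ki mulr0.
have colD j : \sum_i D i j = \sum_x v x * M x (inr j).
  have -> : \sum_x v x * M x (inr j) = \sum_i \sum_k v (i, k) * (k == j)%:R.
    by rewrite pair_bigA; apply: eq_bigr => -[].
  rewrite exchange_big (bigD1 j) //= [X in _ + X]big1 ?addr0.
    by apply: eq_bigr => i _; rewrite mxE eqxx mulr1.
  by move=> k /negbTE ki; rewrite big1 // => i _; rewrite ki mulr0.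
have D0 i j : (i, j) \notin P -> D i j = 0 by move=> /v0; rewrite mxE.
(* A row meeting [P] is an equation of the system; on any other row [D] vanishes. *)
have row0 i : \sum_j D i j = 0.
  have [iI|iI] := boolP (i \in I).
    by rewrite rowD vM // inE imset_f.
  rewrite big1 // => j _; apply: D0; apply: contra iI => ijP.
  by apply/imsetP; exists (i, j).
have col0 j : j != x0.2 -> \sum_i D i j = 0.
  move=> jx0; have [jJ|jJ] := boolP (j \in J).
    by rewrite colD vM // inE [X in _ || X]imset_f ?orbT // !inE jx0.
  rewrite big1 // => i _; apply: D0; apply: contra jJ => ijP.
  by apply/imsetP; exists (i, j).
exists D; split=> // [|j].
  apply: contraNneq vx => /matrixP/(_ x.1 x.2).
  by rewrite !mxE -surjective_pairing => ->.
have [->|/col0//] := eqVneq j x0.2.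
(* The omitted column: all entries sum to zero by rows, and every other column sum is zero. *)
have : \sum_j \sum_i D i j = 0 by rewrite exchange_big big1.
by rewrite (bigD1 x0.2) //= [X in _ + X]big1 ?addr0 // => k /col0.
Qed.

Definition bounded_matrices (K : realType) (n : nat) (r s : 'rV[nat]_n) :
    set 'M[K]_n :=
  [set A : 'M[K]_n |
     [/\ forall i, \sum_j A i j = (r ord0 i)%:R,
         forall j, \sum_i A i j = (s ord0 j)%:R
       & forall i j, -1 <= A i j <= 1]].

Arguments bounded_matrices K {n} r s.

Definition fractional (K : realType) (m n : nat) (A : 'M[K]_(m, n)) :
    {set 'I_m * 'I_n} :=
  [set x | A x.1 x.2 \isn't a Num.int]%SET.

(** Were all other terms integers, [f i] would be a difference of integers. *)
Lemma int_sum_other_fractional (K : realType) (I : finType) (f : I -> K) (i : I) :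
  \sum_j f j \is a Num.int -> f i \isn't a Num.int ->
  exists2 j, j != i & f j \isn't a Num.int.
Proof.
move=> fint fi; apply/exists_inP; apply: contraNT fi.
rewrite negb_exists_in => /forall_inP fj.
move: fint; rewrite (bigD1 i) //= rpredDr //.
by apply: rpred_sum => j /fj; rewrite negbK.
Qed.

Lemma int_itv_signed (K : realType) (x : K) :
  -1 <= x <= 1 -> x \is a Num.int -> x \in [:: 0; 1; -1].
Proof.
move=> /andP[x1 x2] /intrP[k kx].
have k1 : -1 <= k by rewrite -(ler_int K) -kx.
have k2 : k <= 1 by rewrite -(ler_int K) -kx.
rewrite kx; move: k1 k2.
(* Only 0, 1 and [Negz 0], which is -1, survive the two bounds. *)
by case: (k) => [[|[|?]]|[|?]] // _ _; rewrite !inE eqxx ?orbT.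
Qed.

Lemma fractional_itvoo (K : realType) (x : K) :
  -1 <= x <= 1 -> x \isn't a Num.int -> -1 < x < 1.
Proof.
move=> /andP[x1 x2] xN; rewrite !lt_neqAle x1 x2 !andbT.
apply/andP; split; first by apply: contraNneq xN => <-; rewrite rpredN rpred1.
by apply: contraNneq xN => ->; rewrite rpred1.
Qed.

(* The step length is the first time at which an entry of A + t *: D reaches
   the bound 1 or -1. *)
Lemma push_to_boundary (K : realType) (n : nat) (r s : 'rV[nat]_n)
    (A D : 'M[K]_n) : bounded_matrices K r s A -> D != 0 ->
  (forall i j, (i, j) \notin fractional A -> D i j = 0) ->
  (forall i, \sum_j D i j = 0) -> (forall j, \sum_i D i j = 0) ->
  exists2 t, 0 < t & bounded_matrices K r s (A + t *: D) /\
    fractional (A + t *: D) \proper fractional A.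
Proof.
move=> [Ar As A1] DN0 Dfrac Dr Ds.
have /existsP[x0 x0D] : [exists x, D x.1 x.2 != 0].
  apply: contraNT DN0; rewrite negb_exists => /forallP D0.
  apply/eqP/matrixP => i j; rewrite mxE; apply/eqP.
  by rewrite -[_ == _]negbK (D0 (i, j)).
(* The time at which the entry reaches 1 if it increases, -1 if it decreases. *)
pose tau (x : 'I_n * 'I_n) := (Num.sg (D x.1 x.2) - A x.1 x.2) / D x.1 x.2.
have [x /= xD xmin] := @arg_minP _ K _ x0 [pred x | D x.1 x.2 != 0] tau x0D.
have Alt y : D y.1 y.2 != 0 -> -1 < A y.1 y.2 < 1.
  move=> yD; apply: fractional_itvoo => //.
  have : (y.1, y.2) \in fractional A by apply: contraNT yD => /Dfrac ->.
  by rewrite inE.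
(* Since the entry of [A] lies strictly between -1 and 1, the numerator of [tau x] has the sign of
   its denominator. *)
have tau0 : 0 < tau x.
  have /andP[] := Alt x xD; rewrite /tau.
  have [Dx|Dx|Dx] := sgrP (D x.1 x.2); first by rewrite Dx eqxx in xD.
    by move=> _ ?; rewrite divr_gt0 // subr_gt0.
  by move=> ? _; rewrite ltr_ndivlMr // mul0r; lra.
exists (tau x) => //; split.
  split=> [i|j|i j].
  - under eq_bigr do rewrite !mxE.
    by rewrite big_split /= -mulr_sumr Dr mulr0 addr0.
  - under eq_bigr do rewrite !mxE.
    by rewrite big_split /= -mulr_sumr Ds mulr0 addr0.
  have [Dij|Dij] := eqVneq (D i j) 0.
    by rewrite !mxE Dij mulr0 addr0.
  (* Minimality of [tau x] gives the bound towards which the entry moves; it moves away from the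
     other one. *)
  have /andP[] := Alt (i, j) Dij; have := xmin (i, j) Dij.
  rewrite !mxE {2}/tau /=; have [Dx|Dx|Dx] := sgrP (D i j).
  - by rewrite Dx eqxx in Dij.
  - rewrite ler_pdivlMr // => ? ? ?.
    have : 0 < tau x * D i j by rewrite mulr_gt0.
    by move=> ?; apply/andP; split; lra.
  - rewrite ler_ndivlMr // => ? ? ?.
    have : tau x * D i j < 0 by rewrite pmulr_rlt0.
    by move=> ?; apply/andP; split; lra.
(* Integral entries of [A] stay fixed, as [D] vanishes there; the entry at [x] becomes the sign of
   [D], an integer, so the inclusion is strict. *)
apply/properP; split.
  apply/fintype.subsetP => y; apply: contraLR => yA.
  have := yA; rewrite !inE !negbK !mxE => yint.
  by rewrite Dfrac ?mulr0 ?addr0 // -surjective_pairing.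
exists x; first by apply: contraNT xD => xA; rewrite Dfrac // -surjective_pairing.
by rewrite !inE negbK !mxE divfK // addrC subrK; case: sgrP; rewrite ?rpredN ?rpred0 ?rpred1.
Qed.

Lemma conv_lmodE (K : numDomainType) (V : lmodType K) (l : {i01 K})
    (x y : convex_lmodType V) :
  conv l x y = l%:num *: (x : V) + (1 - l%:num) *: (y : V).
Proof. by []. Qed.

Lemma bounded_matrices_convex (K : realType) (n : nat) (r s : 'rV[nat]_n) :
  @convex_set K 'M[K]_n (bounded_matrices K r s).
Proof.
move=> A B l /set_mem[Ar As A1] /set_mem[Br Bs B1]; apply/mem_set.
rewrite conv_lmodE.
have l0 : 0 <= l%:num by [].
have l1 : l%:num <= 1 by [].
split=> [i|j|i j].
- under eq_bigr do rewrite !mxE.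
  by rewrite big_split /= -!mulr_sumr Ar Br; ring.
- under eq_bigr do rewrite !mxE.
  by rewrite big_split /= -!mulr_sumr As Bs; ring.
- rewrite !mxE; have /andP[? ?] := A1 i j; have /andP[? ?] := B1 i j.
  by apply/andP; split; nra.
Qed.

(** The weights [b / (a + b)] and [a / (a + b)] make the displacements along [D] cancel. *)
Lemma convex_set_segment (K : realType) (V : lmodType K) (C : set V) (A D : V)
    (a b : K) : @convex_set K V C -> 0 < a -> 0 < b ->
  C (A + a *: D) -> C (A - b *: D) -> C A.
Proof.
move=> Cconv a0 b0 Ca Cb.
have ab0 : 0 < a + b by rewrite addr_gt0.
have l0 : 0 <= b / (a + b) by rewrite divr_ge0 // ltW.
have l1 : b / (a + b) <= 1 by rewrite ler_pdivrMr // mul1r lerDr ltW.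
have := Cconv _ _ (Itv01 l0 l1) (mem_set Ca) (mem_set Cb).
rewrite conv_lmodE => /set_mem; congr C => /=.
have -> : 1 - b / (a + b) = a / (a + b) by field; rewrite gt_eqF.
have ba : b / (a + b) * a = a / (a + b) * b by ring.
rewrite scalerBr scalerDr !scalerA ba addrACA subrr addr0 -scalerDl -mulrDl.
by rewrite [b + a]addrC divff ?gt_eqF // scale1r.
Qed.

(** An arbitrary convex [C] is used because the hull is the intersection of all convex sets
    containing the signed matrices. *)
Lemma bounded_matrices_sub_convex (K : realType) (n : nat) (r s : 'rV[nat]_n)
    (C : set 'M[K]_n) : @convex_set K 'M[K]_n C ->
  signed_matrices K r s `<=` C -> bounded_matrices K r s `<=` C.
Proof.
move=> Cconv sC A; have [k] := ubnP #|fractional A|.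
elim: k A => // k IH A /ltnSE kA bA; have [Ar As A1] := bA.
have [fr0|frN0] := eqVneq (fractional A) finset.set0.
  apply: sC; split=> // i j; apply: int_itv_signed => //.
  have : (i, j) \notin fractional A by rewrite fr0 inE.
  by rewrite inE negbK.
have [] := @exists_zero_line_sums K n n (fractional A) frN0.
- move=> [i j]; rewrite inE /= => ijA.
  have [|j' j'j ij'] := @int_sum_other_fractional K _ (A i) j _ ijA.
    by rewrite Ar rpred_nat.
  exists (i, j'); first by rewrite inE.
  by split=> //; apply: contra_neq j'j => -[].
- move=> [i j]; rewrite inE /= => ijA.
  have [|i' i'i i'j] := @int_sum_other_fractional K _ (A ^~ j) i _ ijA.
    by rewrite As rpred_nat.
  exists (i', j); first by rewrite inE.
  by split=> //; apply: contra_neq i'i => -[].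
move=> D [DN0 Dfr Dr Ds].
(* The two step lengths [a] and [b] may differ; [- D] inherits the support and the zero line sums of
   [D]. *)
have [a a0 [Ca /proper_card ltA]] := push_to_boundary bA DN0 Dfr Dr Ds.
have [||||b b0 [Cb /proper_card ltB]] := @push_to_boundary K n r s A (- D) bA.
- by rewrite oppr_eq0.
- by move=> i j /Dfr; rewrite mxE => ->; rewrite oppr0.
- by move=> i; under eq_bigr do rewrite mxE; rewrite sumrN Dr oppr0.
- by move=> j; under eq_bigr do rewrite mxE; rewrite sumrN Ds oppr0.
apply: (convex_set_segment Cconv a0 b0) (IH _ _ Ca) _; first exact: leq_trans kA.
by rewrite -scalerN; apply: IH Cb; apply: leq_trans kA.
Qed.

Theorem theorem3p11 (K : realType) (n : nat) (r s : 'rV[nat]_n) :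
  convex_hull (signed_matrices K r s) =
  [set A : 'M[K]_n |
     [/\ forall i, \sum_j A i j = (r ord0 i)%:R,
         forall j, \sum_i A i j = (s ord0 j)%:R
       & forall i j, -1 <= A i j <= 1]].
Proof.
apply/seteqP; split.
  apply: smallest_sub; first exact: bounded_matrices_convex.
  move=> A [A01 Ar As]; split=> // i j.
  by have := A01 i j; rewrite !inE => /or3P[] /eqP ->; apply/andP; split; lra.
by move=> A bA C [Cconv sC]; apply: bounded_matrices_sub_convex bA.
Qed.
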